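(* Let $G=(V,E)$ be a graph and let $v\in V$ be a vertex that is not a pendant vertex. Then $$\gamma_{sp}(G\odot v)\leq \gamma_{sp}(G)+\left\lfloor \frac{\deg(v)}{2}\right\rfloor-1.$$
   Context: Graphs are simple, without loops and directed edges. $N(v)=\{u\in V : uv\in E\}$ denotes the open neighbourhood of $v$, and $\deg(v)=|N(v)|$ is the degree of $v$ in $G$. A pendant vertex is a vertex of degree 1. For $S\subseteq V$ write $\overline{S}=V\setminus S$. A set $S\subseteq V$ is dominating if every vertex of $\overline{S}$ is adjacent to at least one vertex of $S$. A dominating set $S$ is a super dominating set of $G$ if for every $u\in\overline{S}$ there exists $w\in S$ with $N(w)\cap\overline{S}=\{u\}$. The super domination number $\gamma_{sp}(G)$ is the cardinality of a smallest super dominating set of $G$. For $v\in V$, $G\odot v$ is the graph obtained from $G$ by the removal of all edges between any pair of neighbours of $v$ (the vertex set is unchanged).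
   Formalization: The vertex v is additionally assumed not to be isolated, so deg(v) ≥ 2: if deg(v) = 0 then G⊙v = G and the stated inequality would read γ_sp(G) ≤ γ_sp(G) − 1, which is always false. *)

(* Defs.v *)
From mathcomp Require Import all_boot.

Set Implicit Arguments.
Unset Strict Implicit.
Unset Printing Implicit Defensive.

Record sgraph (V : finType) := SGraph {
  adj :> rel V;
  adj_sym : symmetric adj;
  adj_irrefl : irreflexive adj
}.

Definition open_nbh (V : finType) (G : sgraph V) (v : V) : {set V} :=
  [set u | adj G u v].

Definition deg (V : finType) (G : sgraph V) (v : V) : nat := #|open_nbh G v|.

Definition pendant (V : finType) (G : sgraph V) (v : V) : bool := deg G v == 1.

Definition isolated (V : finType) (G : sgraph V) (v : V) : bool := deg G v == 0.

Definition dominating (V : finType) (G : sgraph V) (S : {set V}) : bool :=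
  [forall u in ~: S, exists w in S, adj G u w].

Definition super_dominating (V : finType) (G : sgraph V) (S : {set V}) : bool :=
  dominating G S
  && [forall u in ~: S, exists w in S, open_nbh G w :&: ~: S == [set u]].

(* [set: V] is super dominating, so the arg min below is a genuine minimum. *)
Lemma super_dominating_setT (V : finType) (G : sgraph V) :
  super_dominating G [set: V].
Proof.
by apply/andP; split; apply/forall_inP => u; rewrite in_setC in_setT.
Qed.

Definition gamma_sp (V : finType) (G : sgraph V) : nat :=
  #|[arg min_(S < [set: V] | super_dominating G S) #|S|]|.

Definition odot_rel (V : finType) (G : sgraph V) (v : V) : rel V :=
  fun x y => adj G x y && ~~ ((x \in open_nbh G v) && (y \in open_nbh G v)).

Lemma odot_sym (V : finType) (G : sgraph V) (v : V) : symmetric (odot_rel G v).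
Proof. by move=> x y; rewrite /odot_rel adj_sym [(x \in _) && _]andbC. Qed.

Lemma odot_irrefl (V : finType) (G : sgraph V) (v : V) :
  irreflexive (odot_rel G v).
Proof. by move=> x; rewrite /odot_rel adj_irrefl. Qed.

Definition odot (V : finType) (G : sgraph V) (v : V) : sgraph V :=
  SGraph (@odot_sym V G v) (@odot_irrefl V G v).

(* Main.v *)
Require Import Defs.
From mathcomp Require Import all_boot.
From mathcomp Require Import zify.

Set Implicit Arguments.
Unset Strict Implicit.
Unset Printing Implicit Defensive.

(** Let [T] be the complement of a minimum super dominating set of [G] and let
    [f] choose for every [u] in [T] a private neighbour [f u] outside [T].
    Passing to [odot G v] only spoils the pairs [(u, f u)] with both ends in
    [N(v)]; let [B] be the set of the corresponding [u].  The pairs are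
    disjoint, so [#|B| <= deg v / 2], and [T :\: B] is still admissible.  When
    [B] is nonempty, [v] is neither in [T] nor a private neighbour, and one
    vertex can be regained:
    - if [T :\: B] misses [N(v)], put back some [u0] of [B], with private
      neighbour [v];
    - if [f] maps no vertex of [T :\: B] into [N(v)], add [v], with private
      neighbour [f u0];
    - otherwise [N(v)] contains two vertices outside the spoilt pairs, whence
      [#|B| + 1 <= deg v / 2] and nothing has to be regained. *)

Definition private_nbh (V : finType) (G : sgraph V) (T : {set V}) (f : V -> V) :=
  forall u, u \in T ->
    [/\ f u \notin T, adj G (f u) u
      & forall t, t \in T -> adj G (f u) t -> t = u].

Lemma super_dominatingP (V : finType) (G : sgraph V) (S : {set V}) :
  super_dominating G S <-> exists f, private_nbh G (~: S) f.
Proof.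
split=> [/andP[_ /forall_inP sd] | [f fP]].
  (* The default [u] is never returned: [sd] supplies a witness for every [u] outside [S]. *)
  exists (fun u => odflt u [pick w in S | open_nbh G w :&: ~: S == [set u]]).
  move=> u uT; have /exists_inP[w0 w0S w0P] := sd u uT.
  case: pickP => [w /andP[wS /eqP wP] /= | /(_ w0)]; last by rewrite w0S w0P.
  have wE t : (adj G w t && (t \in ~: S)) = (t == u).
    by rewrite -in_set1 -wP [RHS]inE [t \in open_nbh _ _]inE adj_sym.
  split; first by rewrite inE wS.
    by have := wE u; rewrite eqxx => /andP[].
  by move=> t tT wt; apply/eqP; rewrite -wE wt tT.
apply/andP; split; apply/forall_inP => u uT; have [fuT fu uniq_u] := fP u uT;
  (apply/exists_inP; exists (f u); first by rewrite inE negbK in fuT).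
  by rewrite adj_sym.
apply/eqP/setP => t; rewrite in_setI [t \in open_nbh _ _]inE in_set1 adj_sym.
apply/andP/eqP => [[ft tT]|->]; first exact: uniq_u.
by [].
Qed.

Lemma gamma_sp_le (V : finType) (G : sgraph V) (T : {set V}) (f : V -> V) :
  private_nbh G T f -> gamma_sp G + #|T| <= #|V|.
Proof.
move=> fP; rewrite -(cardsC T) addnC leq_add2l /gamma_sp.
case: arg_minnP => [|S _ minS]; first exact: super_dominating_setT.
by apply: minS; apply/super_dominatingP; exists f; rewrite setCK.
Qed.

Lemma gamma_sp_attained (V : finType) (G : sgraph V) :
  exists T f, private_nbh G T f /\ gamma_sp G + #|T| = #|V|.
Proof.
rewrite /gamma_sp; case: arg_minnP => [|S /super_dominatingP[f fP] _].
  exact: super_dominating_setT.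
by exists (~: S), f; rewrite cardsC.
Qed.

Lemma private_nbh_inj (V : finType) (G : sgraph V) (T : {set V}) (f : V -> V) :
  private_nbh G T f -> {in T &, injective f}.
Proof.
move=> fP t u tT uT ftu; have [_ ft _] := fP t tT; have [_ _ uniq_u] := fP u uT.
by apply: uniq_u; rewrite // -ftu.
Qed.

Section Spoilt.

Variables (V : finType) (G : sgraph V) (v : V) (T : {set V}) (f : V -> V).
Hypothesis fP : private_nbh G T f.

Definition spoilt : {set V} := [set u in T | adj G v u && adj G v (f u)].

Let U := T :\: spoilt.

Lemma odot_adjE x y :
  adj (odot G v) x y = adj G x y && ~~ (adj G v x && adj G v y).
Proof. by rewrite /= /odot_rel !inE ![adj G v _]adj_sym. Qed.

Lemma odot_sub x y : adj (odot G v) x y -> adj G x y.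
Proof. by rewrite odot_adjE => /andP[]. Qed.

Lemma odot_adj_center x : adj (odot G v) v x = adj G v x.
Proof. by rewrite odot_adjE adj_irrefl andbT. Qed.

Lemma spoiltP u :
  reflect [/\ u \in T, adj G v u & adj G v (f u)] (u \in spoilt).
Proof. by rewrite inE; apply: and3P. Qed.

(** Uniqueness is kept relative to all of [T], not only [U], so that it survives putting a spoilt
    vertex back. *)
Lemma unspoiltP u : u \in U ->
  [/\ u \in T, f u \notin T, adj (odot G v) (f u) u
    & forall t, t \in T -> adj (odot G v) (f u) t -> t = u].
Proof.
case/setDP=> uT uB; have [fuT fu uniq_u] := fP uT; split=> //.
  by rewrite odot_adjE fu; apply: contra uB => /andP[? ?]; apply/spoiltP.
by move=> t tT /odot_sub; apply: uniq_u.
Qed.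

Lemma private_unspoilt : private_nbh (odot G v) U f.
Proof.
move=> u /unspoiltP[uT fuT fu uniq_u]; split=> //.
  by rewrite inE negb_and fuT orbT.
by move=> t /setDP[tT _]; apply: uniq_u.
Qed.

(** The only neighbour of [f u0] in [T] is [u0], and [v] is adjacent to both. *)
Lemma center_notin u0 : u0 \in spoilt -> v \notin T.
Proof.
case/spoiltP=> u0T vu0 vf; have [_ _ uniq_u] := fP u0T.
apply/negP => vT; have vE : v = u0 by apply: uniq_u; rewrite // adj_sym.
by rewrite -vE adj_irrefl in vu0.
Qed.

Lemma center_unmatched u0 u : u0 \in spoilt -> u \in T -> f u != v.
Proof.
case/spoiltP=> u0T vu0 vf uT; have [_ _ uniq_u] := fP uT.
apply/eqP => fuv; have uE : u0 = u by apply: uniq_u; rewrite // fuv.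
by rewrite uE fuv adj_irrefl in vf.
Qed.

(** All edges at [v] survive in [odot G v], so [u0] is its only neighbour in [u0 |: U]. *)
Lemma private_regain_spoilt u0 : u0 \in spoilt ->
    (forall y, y \in U -> ~~ adj G v y) ->
  private_nbh (odot G v) (u0 |: U) (fun u => if u == u0 then v else f u).
Proof.
move=> u0B UNv; have [u0T vu0 _] := spoiltP _ u0B.
have sub t : t \in u0 |: U -> t \in T.
  by case/setU1P=> [->//|/setDP[]].
move=> u; case: eqP => [-> _ | /eqP u'0].
  split.
  - by apply: contra (center_notin u0B); apply: sub.
  - by rewrite odot_adj_center.
  move=> t /setU1P[//|/UNv]; rewrite odot_adj_center.
  by move=> /negbTE ->.
rewrite in_setU1 (negbTE u'0) => /unspoiltP[uT fuT fu uniq_u]; split=> //.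
  by apply: contra fuT; apply: sub.
by move=> t /sub; apply: uniq_u.
Qed.

(** The vertex [f u0] is adjacent to [v], and its only neighbour in [T], namely [u0], is not in
    [U]. *)
Lemma private_regain_center u0 : u0 \in spoilt ->
    (forall z, z \in U -> ~~ adj G v (f z)) ->
  private_nbh (odot G v) (v |: U) (fun u => if u == v then f u0 else f u).
Proof.
move=> u0B fUNv; have [u0T vu0 vf] := spoiltP _ u0B.
have [fu0T _ uniq_u0] := fP u0T.
have notin u : u \in T -> f u \notin T -> f u \notin v |: U.
  move=> uT fuT; rewrite in_setU1 (negbTE (center_unmatched u0B uT)) /=.
  by rewrite inE negb_and fuT orbT.
move=> u; case: eqP => [-> _ | /eqP u'v].
  split; first exact: notin.
  - by rewrite adj_sym odot_adj_center.
  move=> t /setU1P[//|/setDP[tT tB]] /odot_sub ft.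
  by rewrite (uniq_u0 t tT ft) u0B in tB.
rewrite in_setU1 (negbTE u'v) orFb => uU.
have [uT fuT fu uniq_u] := unspoiltP uU; split; [exact: notin | exact: fu |].
move=> t /setU1P[->|/setDP[tT _]]; last exact: uniq_u.
by rewrite adj_sym odot_adj_center (negbTE (fUNv u uU)).
Qed.

(** Inside [N(v)], the set [A] lies in [T] and the injective image of [C] under [f] lies outside
    [T], so they are disjoint. *)
Lemma leq_card_deg (A C : {set V}) :
    (forall a, a \in A -> a \in T /\ adj G v a) ->
    (forall c, c \in C -> c \in T /\ adj G v (f c)) ->
  #|A| + #|C| <= deg G v.
Proof.
move=> AP CP; have cardF : #|f @: C| = #|C|.
  by apply: card_in_imset => a b /CP[aT _] /CP[bT _]; apply: (private_nbh_inj fP).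
have disj : A :&: f @: C = set0.
  apply/setP => t; rewrite in_setI in_set0; apply/andP => -[/AP[tT _]].
  by case/imsetP=> u /CP[uT _] tE; have [] := fP uT; rewrite -tE tT.
rewrite -cardF -[_ + _]subn0 -(cards0 V) -disj -cardsU.
apply/subset_leq_card/subsetP => t; rewrite [t \in open_nbh _ _]inE adj_sym.
by case/setUP=> [/AP[]//|/imsetP[u /CP[_ ?] ->]].
Qed.

Lemma card_spoilt_le : #|spoilt| <= (deg G v)./2.
Proof.
have : #|spoilt| + #|spoilt| <= deg G v; last by lia.
by apply: leq_card_deg => u /spoiltP[].
Qed.

Lemma card_spoilt_lt y z :
  y \in U -> adj G v y -> z \in U -> adj G v (f z) -> #|spoilt| < (deg G v)./2.
Proof.
move=> /setDP[yT yB] vy /setDP[zT zB] vfz.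
(* Each side of the count gains one vertex, even when [y = z]. *)
have : #|y |: spoilt| + #|z |: spoilt| <= deg G v; last first.
  by rewrite !cardsU1 yB zB; lia.
by apply: leq_card_deg => u /setU1P[->|/spoiltP[]].
Qed.

Lemma card_unspoilt : #|spoilt| + #|U| = #|T|.
Proof.
have BT : spoilt \subset T by apply/subsetP => u /spoiltP[].
by rewrite -(cardsID spoilt T) (setIidPr BT).
Qed.

End Spoilt.

Theorem theorem2p6 (V : finType) (G : sgraph V) (v : V)
    (v_not_pendant : ~~ pendant G v) (v_not_isolated : ~~ isolated G v) :
  gamma_sp (odot G v) <= gamma_sp G + (deg G v)./2 - 1.
Proof.
(* Hence the truncated [- 1] is a true subtraction, and [B] is nonempty once it reaches half the
   degree. *)
have deg_ge2 : 1 < deg G v.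
  by move: v_not_pendant v_not_isolated; rewrite /pendant /isolated; lia.
have [T [f [fP gammaE]]] := gamma_sp_attained G.
set B := spoilt G v T f.
have cardT : #|B| + #|T :\: B| = #|T| by apply: card_unspoilt.
have cardB : #|B| <= (deg G v)./2 := card_spoilt_le v fP.
have [B_lt | B_ge] := ltnP #|B| (deg G v)./2.
  have := gamma_sp_le (private_unspoilt (v := v) fP); rewrite -/B; lia.
have [u0 u0B] : exists u0, u0 \in B by apply/card_gt0P; lia.
have [/exists_inP[y yU vy] | /exists_inPn UNv] :=
    boolP [exists y in T :\: B, adj G v y]; last first.
  have := gamma_sp_le (private_regain_spoilt fP u0B UNv).
  have u0U : u0 \notin T :\: B by rewrite in_setD u0B.
  rewrite -/B cardsU1 u0U; lia.
have [/exists_inP[z zU vfz] | /exists_inPn fUNv] :=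
    boolP [exists z in T :\: B, adj G v (f z)]; last first.
  have := gamma_sp_le (private_regain_center fP u0B fUNv).
  have vU : v \notin T :\: B.
    by rewrite in_setD negb_and (center_notin fP u0B) orbT.
  rewrite -/B cardsU1 vU; lia.
(* This last case contradicts [B_ge]. *)
by have := card_spoilt_lt fP yU vy zU vfz; rewrite -/B; lia.
Qed.
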